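(* Every locally compact, second countable group $G$ has a plig metric $d$ for which the $d$-balls have exponentially controlled growth.
   Context: Topological groups are assumed Hausdorff; $G$ is locally compact if every point has a relatively compact neighbourhood. A plig metric on a topological group $G$ is a metric $d$ on $G$ which is: proper (all closed $d$-bounded subsets of $G$ are compact), left invariant ($d(gx,gy)=d(x,y)$ for all $g,x,y\in G$), and generates the given topology of $G$. Let $\mu$ denote the (left) Haar measure on $G$, $e$ the identity of $G$, $B_d(e,r)=\{y\in G: d(e,y)<r\}$, and $\mathbb N=\{1,2,3,\dots\}$. The $d$-balls have exponentially controlled growth if there exist constants $\alpha,\beta>0$ such that $$\mu(B_d(e,n))\le \beta e^{\alpha n}\quad\text{for all } n\in\mathbb{N}.$$ *)

(* Defs.v *)
From HB Require Import structures.
From mathcomp Require Import all_boot all_order all_algebra.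
From mathcomp Require Import all_classical all_reals all_analysis.

Set Implicit Arguments.
Unset Strict Implicit.
Unset Printing Implicit Defensive.

Import Order.TTheory GRing.Theory Num.Theory.
Import numFieldNormedType.Exports.

Local Open Scope classical_set_scope.
Local Open Scope ring_scope.

HB.mixin Record isTopologicalGroup G & Topological G & Group G := {
  mulg_continuous : continuous (fun x : G * G => (x.1 * x.2)%g) ;
  invg_continuous : continuous (fun x : G => (x^-1)%g) ;
}.

(* Hausdorff separation is not part of the structure. *)
#[short(type="topologicalGroupType")]
HB.structure Definition TopologicalGroup :=
  {G of Topological G & Group G & isTopologicalGroup G}.

(* The library's generated sigma-algebras live on pointed types: this alias of
   [G] is pointed at the identity. *)
Definition pointed_group (G : topologicalGroupType) : Type := G.
HB.instance Definition _ (G : topologicalGroupType) :=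
  Choice.on (pointed_group G).
HB.instance Definition _ (G : topologicalGroupType) :=
  isPointed.Build (pointed_group G) (1%g : G).

Notation borelType G :=
  (g_sigma_algebraType (@open G : set (set (pointed_group G)))).

Section haar.
Context {R : realType} {G : topologicalGroupType}.

Record is_left_haar (mu : {measure set (borelType G) -> \bar R}) : Prop := {
  haar_neq0 : mu [set: G] <> 0%E ;
  haar_invariant : forall (g : G) (A : set G),
    measurable (A : set (borelType G)) ->
    mu [set (g * x)%g | x in A] = mu A ;
  haar_compact : forall K : set G, compact K -> (mu K < +oo)%E ;
  haar_outer : forall A : set G, measurable (A : set (borelType G)) ->
    mu A = ereal_inf [set mu U | U in [set U : set G | open U /\ A `<=` U]] ;
  haar_inner : forall U : set G, open U ->
    mu U = ereal_sup [set mu K | K in [set K : set G | compact K /\ K `<=` U]]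
}.

End haar.

Section plig.
Context {R : realType} {G : topologicalGroupType}.
Implicit Type d : G -> G -> R.

Definition dball d (x : G) (r : R) : set G := [set y | d x y < r].

Record is_metric d : Prop := {
  is_metric_ge0 : forall x y, 0 <= d x y ;
  is_metric_eq0 : forall x y, d x y = 0 <-> x = y ;
  is_metric_sym : forall x y, d x y = d y x ;
  is_metric_triangle : forall x y z, d x z <= d x y + d y z
}.

Definition dbounded d (A : set G) : Prop :=
  exists M : R, forall x y, A x -> A y -> d x y <= M.

Definition generates_topology d : Prop :=
  forall A : set G,
    open A <-> forall x, A x -> exists2 r, 0 < r & dball d x r `<=` A.

(* [closed] refers to the given topology of [G]; for a plig metric this is the
   topology of [d], by [plig_topology]. *)
Record is_plig d : Prop := {
  plig_metric : is_metric d ;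
  plig_proper : forall A : set G, closed A -> dbounded d A -> compact A ;
  plig_left_invariant : forall g x y, d (g * x)%g (g * y)%g = d x y ;
  plig_topology : generates_topology d
}.

Definition exponentially_controlled_growth
    (mu : {measure set (borelType G) -> \bar R}) d : Prop :=
  exists alpha beta : R, [/\ 0 < alpha, 0 < beta &
    forall n : nat, (0 < n)%N ->
      (mu (dball d 1%g n%:R) <= (beta * expR (alpha * n%:R))%:E)%E].

End plig.

(* Main.v *)
Require Import Defs.
From HB Require Import structures.
From mathcomp Require Import all_boot all_order all_algebra.
From mathcomp Require Import all_classical all_reals all_analysis.
From mathcomp Require Import zify lra.

Set Implicit Arguments.
Unset Strict Implicit.
Unset Printing Implicit Defensive.

Import Order.TTheory GRing.Theory Num.Theory.
Import numFieldNormedType.Exports.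

Local Open Scope classical_set_scope.
Local Open Scope ring_scope.

(** Left-invariant compatible metrics on [G] correspond to compatible lengths
    [l], through [d x y = l (x^-1 * y)], and the whole construction is done on
    lengths.

    A bounded length is obtained from Urysohn functions. If [f] is continuous
    and constant outside a compact set, then [x |-> sup_g |f (g x) - f g|] is
    subadditive, symmetric and continuous at the identity. Taking functions
    [f n] that separate the identity from the complements of a countable basis
    of neighbourhoods, and scaling the [n]-th one by [1 / (n + 1)], the supremum
    over [n] is a compatible length [l <= 1] whose open unit ball [U] is
    relatively compact ([bounded_length_exists]).

    To make the metric proper, write [G] as a union of compact symmetric sets
    [K m], with [U] contained in [K 0]. Let a letter of [U] weigh
    [cost 0 * l x], and a letter outside [U], assigned to some [K m] that
    contains it, weigh [cost m]; the new length of [x] is the infimum of the weights of the words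
    with product [x]. It dominates [cost 0 * l] and equals it on [U], so the
    topology is unchanged.

    The costs are chosen against the size of the [K m]: the relatively compact set
    [U U K m] is covered by finitely many translates [a U], with [a] in [F m],
    and [cost m] exceeds [size (F m) + m]. A word of weight less than [n] either
    has its product in [U], or factors as a prefix with product in [U], a letter
    of some [K m], and a remainder of weight less than [n - cost m]
    ([first_jump]). So, with [B n] the set of products of words of weight less
    than [n],

      [U B n] is contained in [U U] together with the [a U B (n - cost m)],
      for [a] in [F m] and [cost m <= n],

    and the number of translates of a compact set [D] containing [U U] that are
    needed to cover [U B n] is at most
    [1 + \sum_m size (F m) * 2 ^ (n - cost m) <= 2 ^ n], by induction
    ([weight_ball_cover]). That single estimate gives both conclusions: balls
    are relatively compact, and every left-invariant measure that is finite on
    compact sets gives the ball of radius [n] a mass at most [2 ^ n * mu D]. *)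

(** * Translations and compactness in topological groups *)

Section translations.
Context {G : topologicalGroupType}.
Implicit Types (A B V : set G) (g x : G).

Lemma lmul_continuous g : continuous (fun x : G => (g * x)%g).
Proof.
move=> x; apply: (@continuous_comp _ _ _ (pair g)
  (fun y : G * G => (y.1 * y.2)%g)); last exact: mulg_continuous.
exact: cvg_pair (cvg_cst g) cvg_id.
Qed.

Lemma nbhs_lmul x A : nbhs x A <-> nbhs 1%g [set y | A (x * y)%g].
Proof.
split=> [xA|]; first by apply: lmul_continuous; rewrite mulg1.
move=> /= A1; have : nbhs x [set y | A (x * (x^-1 * y))%g].
  by apply: (@lmul_continuous x^-1%g x [set y | A (x * y)%g]); rewrite mulVg.
by apply: filterS => y /=; rewrite mulVKg.
Qed.

Lemma nbhs1V V : nbhs 1%g V -> nbhs 1%g [set x : G | V x^-1%g].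
Proof. by move=> V1; apply: invg_continuous; rewrite invg1. Qed.

Lemma compact_lmul g A : compact A -> compact [set (g * x)%g | x in A].
Proof.
move=> cA; apply: continuous_compact => //.
by apply: continuous_subspaceT => x; exact: lmul_continuous.
Qed.

Lemma compact_mul A B :
  compact A -> compact B -> compact [set (x * y)%g | x in A & y in B].
Proof.
move=> cA cB; rewrite image2E.
have -> : uncurry (fun x y : G => (x * y)%g) = (fun z : G * G => (z.1 * z.2)%g).
  by apply/funext => -[].
apply: continuous_compact; last exact: compact_setX.
by apply: continuous_subspaceT => x; exact: mulg_continuous.
Qed.

Lemma compact_inv A : compact A -> compact [set x^-1%g | x in A].
Proof.
move=> cA; apply: continuous_compact => //.
by apply: continuous_subspaceT => x; exact: invg_continuous.
Qed.

(** The near-covering form of compactness is applied to the filter of all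
    sufficiently large finite lists: near [x], any list containing [x] works. *)
Lemma compact_translates A V : compact A -> nbhs 1%g V ->
  exists s : seq G, forall x, A x -> exists2 a, a \in s & V (a^-1 * x)%g.
Proof.
move=> /compact_near_coveringP cA V1.
pose F : set_system (seq G) :=
  filter_from setT (fun s0 : seq G => [set s : seq G | {subset s0 <= s}]).
have FF : Filter F.
  apply: filter_from_filter; first by exists [::].
  move=> s t _ _; exists (s ++ t) => // r /= st.
  by split=> x xs; apply: st; rewrite mem_cat xs ?orbT.
have [|s0 _ s0P] :=
    cA _ F (fun s x => exists2 a, a \in s & V (a^-1 * x)%g) FF.
  move=> x Ax; exists ([set y | V (x^-1 * y)%g], [set s | {subset [:: x] <= s}]).
    split; last by exists [:: x].
    by apply/nbhs_lmul; apply: filterS V1 => y Vy /=; rewrite mulKg.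
  by move=> [y s] /= [Vy xs]; exists x => //; apply: xs; rewrite mem_head.
by exists s0 => x Ax; apply: (s0P s0).
Qed.

(** Compactness of [A] makes the continuity of [f] uniform at the points of
    [A]. When only [g * v] lies in [A], the same estimate is used at [g * v]
    with the increment [v^-1]; outside [A] there is nothing to compare. *)
Lemma uniformly_continuous_translation (R : realType) (f : G -> R) A (c : R) :
  continuous f -> compact A -> (forall x, ~ A x -> f x = c) ->
  forall e, 0 < e -> \forall v \near (1%g : G),
    forall g, `|f (g * v)%g - f g| <= e.
Proof.
move=> cf cA fc e e0.
have cA' := (compact_near_coveringP A).1 cA.
have nA : \forall v \near (1%g : G), forall x, A x -> `|f (x * v)%g - f x| <= e.
  apply: (cA' _ (nbhs (1%g : G)) (fun v x => `|f (x * v)%g - f x| <= e) _).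
  move=> x Ax; have e20 : 0 < e / 2 by rewrite divr_gt0.
  have cfx : {for (x, 1%g), continuous (fun y : G * G => f (y.1 * y.2)%g)}.
    apply: (@continuous_comp _ _ _ (fun y : G * G => (y.1 * y.2)%g) f).
      exact: mulg_continuous.
    exact: cf.
  move/cvgrPdist_le : cfx => /(_ _ e20)/=; rewrite mulg1 => nx1.
  have /cvgrPdist_le/(_ _ e20)/= nx2 : f @ x --> f x by exact: cf.
  case: nx1 => -[B W] [/= xB W1] BW.
  exists (B `&` [set y | `|f x - f y| <= e / 2], W).
    by split => //; exact: filterI.
  move=> [y v] /= [[By fy] Wv].
  rewrite (le_trans (ler_distD (f x) _ _))// (splitr e) lerD// distrC.
  exact: (BW (y, v)).
near=> v => g.
have vP : forall x, A x -> `|f (x * v)%g - f x| <= e by near: v.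
have vVP : forall x, A x -> `|f (x * v^-1)%g - f x| <= e.
  by near: v; exact: nbhs1V nA.
have [Ag|nAg] := pselect (A g); first exact: vP.
have [Agv|nAgv] := pselect (A (g * v)%g); last by rewrite !fc// subrr normr0 ltW.
by rewrite distrC -{1}[g](mulgK v); exact: vVP.
Unshelve. all: by end_near.
Qed.
End translations.

(** * Compatible lengths and plig metrics *)

Section lengths.
Context {R : realType} {G : topologicalGroupType}.
Implicit Types (l : G -> R) (x y : G).

(** Nonnegativity follows from these axioms, and so does definiteness when [G]
    is Hausdorff. *)
Record compatible_length l : Prop := {
  length1 : l 1%g = 0 ;
  lengthV : forall x, l x^-1%g = l x ;
  lengthM : forall x y, l (x * y)%g <= l x + l y ;
  length_nbhs : forall V : set G,
    nbhs 1%g V <-> exists2 r, 0 < r & [set x | l x < r] `<=` V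
}.

Lemma length_ge0 l x : compatible_length l -> 0 <= l x.
Proof.
move=> ll; have := lengthM ll x x^-1%g.
by rewrite mulgV (length1 ll) (lengthV ll) -mulr2n pmulrn_lge0.
Qed.

Lemma length_eq0 l x : hausdorff_space G -> compatible_length l ->
  l x = 0 -> x = 1%g.
Proof.
move=> hG ll lx; apply/esym/hG => A B /(length_nbhs ll)[r r0 rA] xB.
by exists x; split; [apply: rA; rewrite /= lx|exact: nbhs_singleton].
Qed.

Definition length_dist l (x y : G) : R := l (x^-1 * y)%g.

(** Left invariance reduces everything to the identity: neighbourhoods of [x]
    are translates of neighbourhoods of the identity, and a bounded set lies in
    a translate of one of the balls assumed relatively compact. *)
Lemma length_dist_plig l : hausdorff_space G -> compatible_length l ->
    (forall n : nat, exists2 C : set G, compact C &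
       [set x | l x < n%:R] `<=` C) ->
  is_plig (length_dist l).
Proof.
move=> hG ll lC; split.
- split=> [x y|x y|x y|x y z].
  + exact: (length_ge0 (x^-1 * y)%g ll).
  + split=> [/(length_eq0 hG ll) xy|->]; last by rewrite /length_dist mulVg length1.
    by rewrite -[y](mulVKg x) xy mulg1.
  + by rewrite /length_dist -(lengthV ll) invgM invgK.
  + have -> : length_dist l x z = l ((x^-1 * y) * (y^-1 * z))%g.
      by rewrite -mulgA mulVKg.
    by apply: (lengthM ll).
- move=> A clA [M AM].
  have [->|/set0P[x Ax]] := eqVneq A set0; first exact: compact0.
  have [C cC lMC] := lC (Num.bound `|M|).
  apply: (subclosed_compact clA (compact_lmul (g := x) cC)) => y Ay.
  exists (x^-1 * y)%g; last exact: mulVKg.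
  apply: lMC; apply: le_lt_trans (AM _ _ Ax Ay) _.
  by rewrite (le_lt_trans (ler_norm M))// archi_boundP.
- by move=> g x y; rewrite /length_dist invgM -mulgA mulKg.
- move=> A; rewrite openE; split=> [oA x /oA /nbhs_lmul /(length_nbhs ll)[r r0 rA]|oA x Ax].
    by exists r => // y /rA /=; rewrite mulVKg.
  have [r r0 rA] := oA x Ax.
  apply/nbhs_lmul/(length_nbhs ll); exists r => // y ly; apply: rA.
  by rewrite /dball /length_dist /= mulKg.
Qed.

End lengths.

(** * A bounded compatible length *)

Section urysohn_length.
Context {R : realType} {G : topologicalGroupType}.

Variables (C : set G) (W : nat -> set G) (f : nat -> G -> R).
Hypothesis compactC : compact C.
Hypothesis W_basis : forall V : set G, nbhs 1%g V -> exists n, W n `<=` V.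
Hypothesis f_continuous : forall n, continuous (f n).
Hypothesis f01 : forall n x, 0 <= f n x <= 1.
Hypothesis f1 : forall n, f n 1%g = 0.
Hypothesis fW : forall n x, ~ W n x -> f n x = 1.
Hypothesis fC : forall n x, ~ C x -> f n x = 1.

(** The factor [n.+1%:R^-1] makes all but finitely many [f n] negligible at any
    given scale, which keeps the supremum continuous at the identity. *)
Definition oscillations (x : G) : set R :=
  [set n.+1%:R^-1 * `|f n (g * x)%g - f n g| | n in [set: nat] & g in [set: G]].

Definition oscillation (x : G) : R := sup (oscillations x).

Lemma oscillations_le1 x : ubound (oscillations x) 1.
Proof.
move=> _ [n _ [g _ <-]]; rewrite -[leRHS]mulr1 ler_pM ?invr_ge0//.
  by rewrite invf_le1 ?ler1n.
rewrite ler_norml; have /andP[? ?] := f01 n g; have /andP[? ?] := f01 n (g * x)%g.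
by apply/andP; split; lra.
Qed.

Lemma le_oscillation n g x :
  n.+1%:R^-1 * `|f n (g * x)%g - f n g| <= oscillation x.
Proof.
by apply: ub_le_sup; [exists 1; exact: oscillations_le1|exists n => //; exists g].
Qed.

Lemma oscillation_le r x :
  (forall n g, n.+1%:R^-1 * `|f n (g * x)%g - f n g| <= r) -> oscillation x <= r.
Proof.
move=> rP; apply: ge_sup; last by move=> _ [n _ [g _ <-]].
by eexists; exists 0%N => //; exists 1%g.
Qed.

Lemma oscillation_le1 x : oscillation x <= 1.
Proof. 
by apply: oscillation_le => n g; apply: oscillations_le1; exists n => //; exists g.
Qed.

(** Translating by [g = 1] already shows that [x] leaves [W n] only if [f n]
    jumps from [0] to [1]. *)
Lemma oscillation_lt_sub n : [set x | oscillation x < n.+1%:R^-1] `<=` W n.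
Proof.
move=> x /= xn; apply: contrapT => /fW fx.
have := le_oscillation n 1%g x.
by rewrite mul1g f1 fx subr0 normr1 mulr1 leNgt xn.
Qed.

(** The indices [n >= N] are harmless because of the factor [n.+1%:R^-1]; each
    of the finitely many others is uniformly continuous under translation. *)
Lemma oscillation_near r : 0 < r -> \forall x \near (1%g : G), oscillation x <= r.
Proof.
move=> r0.
have [N] : exists N : nat, r^-1 < N%:R.
  by exists (Num.bound r^-1); rewrite archi_boundP// invr_ge0 ltW.
move=> rN; have Nr n : (N <= n)%N -> n.+1%:R^-1 <= r.
  move=> Nn; rewrite -[leRHS]invrK lef_pV2 ?posrE ?invr_gt0//.
  by rewrite (le_trans (ltW rN))// ler_nat (leq_trans Nn).
have : \forall x \near (1%g : G), forall n, (n < N)%N ->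
    forall g, `|f n (g * x)%g - f n g| <= r.
  elim: N {rN Nr} => [|N IHN]; first exact: nearW.
  near=> x => n; rewrite ltnS leq_eqVlt => /orP[/eqP->|].
    near: x; exact: (uniformly_continuous_translation
      (@f_continuous N) compactC (fC N) r0).
  by move: n; near: x.
apply: filterS => x xN; apply: oscillation_le => n g.
have n10 : (0 : R) <= n.+1%:R^-1 by rewrite invr_ge0.
have n11 : n.+1%:R^-1 <= (1 : R) by rewrite invf_le1 ?ler1n.
have [nN|Nn] := ltnP n N.
  apply: le_trans (xN n nN g); by rewrite ler_piMl.
apply: le_trans (Nr _ Nn); rewrite ler_piMr//.
have /andP[? ?] := f01 n g; have /andP[? ?] := f01 n (g * x)%g.
by rewrite ler_norml; apply/andP; split; lra.
Unshelve. all: by end_near.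
Qed.

Lemma oscillation_compatible : compatible_length oscillation.
Proof.
split=> [|x|x y|V].
- apply/eqP; rewrite eq_le; apply/andP; split.
    by apply: oscillation_le => n g; rewrite mulg1 subrr normr0 mulr0.
  by apply: le_trans (le_oscillation 0 1%g 1%g); rewrite mulr_ge0.
(* Replacing [g] by [g * x] exchanges the two values of [f n]. *)
- suff le y : oscillation y^-1%g <= oscillation y.
    by apply/eqP; rewrite eq_le le -{1}[x]invgK le.
  apply: oscillation_le => n g; rewrite distrC -{1}[g](mulgVK y).
  exact: le_oscillation.
- apply: oscillation_le => n g; rewrite mulgA.
  have := lerD (le_oscillation n g x) (le_oscillation n (g * x)%g y).
  apply: le_trans; rewrite -mulrDr ler_wpM2l ?invr_ge0// [leRHS]addrC.
  exact: ler_distD.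
- split=> [/W_basis[n WV]|[r r0 rV]].
    by exists n.+1%:R^-1 => //; apply: subset_trans WV; exact: oscillation_lt_sub.
  have r20 : 0 < r / 2 by rewrite divr_gt0.
  apply: filterS (oscillation_near r20) => x xr; apply: rV => /=.
  by rewrite (le_lt_trans xr)// ltr_pdivrMr// ltr_pMr// ltr1n.
Qed.

End urysohn_length.

(** * Consequences of second countability *)

Section enumerations.

Lemma second_countable_seq (T : topologicalType) : @second_countable T ->
  exists B : nat -> set T, (forall n, open (B n)) /\
    forall x V, nbhs x V -> exists2 n, B n x & B n `<=` V.
Proof.
move=> [B /countable_injP[code code_inj] [B_open B_basis]].
have [b bP] : {b : nat -> set T & forall n, open (b n) /\
    forall U, B U -> code U = n -> b n = U}.
  apply: (@choice _ _ (fun n (b : set T) => open b /\ forall U, B U -> code U = n -> b = U)).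
  move=> n; have [[U [BU <-]]|nU] := pselect (exists U, B U /\ code U = n).
    exists U; split=> [|V BV VU]; first exact: B_open.
    by apply: code_inj; rewrite ?inE.
  by exists set0; split=> [|U BU Un]; [exact: open0|case: nU; exists U].
exists b; split=> [n|x V xV]; first by have [] := bP n.
have [U [BU Ux] UV] := B_basis x V xV.
by exists (code U); have [_ /(_ U BU erefl)->] := bP (code U).
Qed.

Lemma compact_nbhs (T : topologicalType) (x : T) : locally_compact [set: T] ->
  exists C : set T, [/\ compact C, closed C & nbhs x C].
Proof.
move=> /(_ x I)[C xC [cC clC]]; exists C; split => //.
have /= : nbhs x (fun y => [set: T] y -> C y) := xC.
by apply: filterS => y; exact.
Qed.

(** The basic open sets contained in a compact set still cover the space; one
    such compact set is chosen for each. *)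
Lemma compact_exhaustion (T : topologicalType) :
  locally_compact [set: T] -> @second_countable T ->
  exists K : nat -> set T, (forall n, compact (K n)) /\ forall x, exists n, K n x.
Proof.
move=> lcT /second_countable_seq[B [_ B_basis]].
have [K KP] : {K : nat -> set T & forall n, compact (K n) /\
    forall C, compact C -> B n `<=` C -> B n `<=` K n}.
  apply: (@choice _ _ (fun n (K : set T) => compact K /\
    forall C, compact C -> B n `<=` C -> B n `<=` K)) => n.
  have [[C [cC BC]]|nC] := pselect (exists C, compact C /\ B n `<=` C).
    by exists C.
  by exists set0; split=> [|C cC BC]; [exact: compact0|case: nC; exists C].
exists K; split=> [n|x]; first by have [] := KP n.
have [C [cC _ /B_basis[n Bx BC]]] := compact_nbhs x lcT.
by exists n; have [_ /(_ C cC BC)] := KP n; apply.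
Qed.

End enumerations.

(** Intersecting the basis with the interior of a compact neighbourhood [C] of
    the identity makes all the Urysohn functions constant outside [C], and puts
    the whole open unit ball inside [C]. *)
Lemma bounded_length_exists (R : realType) (G : topologicalGroupType) :
  hausdorff_space G -> locally_compact [set: G] -> @second_countable G ->
  exists (l : G -> R) (C : set G), [/\ compatible_length l, forall x, l x <= 1,
    compact C & [set x | l x < 1] `<=` C].
Proof.
move=> hG lcG /second_countable_seq[B [B_open B_basis]].
have [C [cC clC C1]] := compact_nbhs (1%g : G) lcG.
pose W n := C° `&` (if `[< B n 1%g >] then B n else setT).
have W_open n : open (W n).
  apply: openI; first exact: open_interior.
  by case: asboolP => // _; exact: openT.
have W1 n : W n 1%g.
  by split; [exact: nbhs_singleton (nbhs_interior C1)|case: asboolP].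
have W_basis V : nbhs (1%g : G) V -> exists n, W n `<=` V.
  move=> /B_basis[n Bn1 BV]; exists n; apply: subset_trans BV.
  by rewrite /W asboolT// => x [].
have [f fP] : {f : nat -> G -> R & forall n, [/\ continuous (f n),
    range (f n) `<=` `[0, 1], f n @` [set 1%g] `<=` [set 0] &
    f n @` (~` W n) `<=` [set 1]]}.
  apply: (@choice _ _ (fun n (f : G -> R) => [/\ continuous f,
    range f `<=` `[0, 1], f @` [set 1%g] `<=` [set 0] &
    f @` (~` W n) `<=` [set 1]])) => n.
  apply/uniform_separatorP; apply: (@locally_compact_completely_regular _ R) => //.
    exact: open_closedC.
  by apply; exact: W1.
have f_cont n : continuous (f n) by case: (fP n).
have f01 n x : 0 <= f n x <= 1.
  have [_ f01 _ _] := fP n.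
  by have /= := f01 (f n x); rewrite in_itv/=; apply; exists x.
have f1 n : f n 1%g = 0 by have [_ _ f1 _] := fP n; apply: f1; exists 1%g.
have fW n x : ~ W n x -> f n x = 1.
  by have [_ _ _ fW] := fP n; move=> nWx; apply: fW; exists x.
have fC n x : ~ C x -> f n x = 1.
  by move=> nCx; apply: fW => -[/interior_subset].
exists (oscillation f), C; split => //.
- exact: (oscillation_compatible cC W_basis f_cont f01 f1 fW fC).
- exact: (oscillation_le1 f01).
- move=> x; have := oscillation_lt_sub f01 f1 fW (n := 0%N) (t := x).
  by rewrite invr1 => /[apply] -[/interior_subset].
Qed.

(** * Word lengths *)

Section word_length.
Context {R : realType} {G : groupType} (w : G -> R).
Hypothesis w_ge0 : forall x, 0 <= w x.

Implicit Types (x y : G) (s : seq G).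

Definition weight s : R := \sum_(y <- s) w y.

Definition word_length x : R :=
  inf [set weight s | s in [set s | (\prod_(y <- s) y)%g = x]].

Lemma weight_ge0 s : 0 <= weight s.
Proof. by apply: sumr_ge0 => y _. Qed.

Lemma word_length_le s : word_length (\prod_(y <- s) y)%g <= weight s.
Proof.
by apply: ge_inf; [exists 0 => _ [t _ <-]; exact: weight_ge0|exists s].
Qed.

Lemma word_length_le_letter x : word_length x <= w x.
Proof. by have := word_length_le [:: x]; rewrite /weight !big_seq1. Qed.

Lemma word_length_lt r x : word_length x < r ->
  exists2 s, (\prod_(y <- s) y)%g = x & weight s < r.
Proof.
move=> /inf_lt[|_ [s sx <-] sr]; last by exists s.
by exists (w x), [:: x] => /=; rewrite /weight big_seq1.
Qed.

(** A subadditive function dominated on letters is dominated on words: this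
    bounds the word length from below by [l]. *)
Lemma le_weight l : l 1%g = 0 -> (forall x y, l (x * y)%g <= l x + l y) ->
  (forall x, l x <= w x) -> forall s, l (\prod_(y <- s) y)%g <= weight s.
Proof.
move=> l1 lM lw; elim=> [|y s IHs]; first by rewrite /weight !big_nil l1.
by rewrite /weight !big_cons (le_trans (lM _ _))// lerD.
Qed.

Lemma le_word_length l : l 1%g = 0 -> (forall x y, l (x * y)%g <= l x + l y) ->
  (forall x, l x <= w x) -> forall x, l x <= word_length x.
Proof.
move=> l1 lM lw x; rewrite leNgt; apply/negP => /word_length_lt[s <-].
by rewrite ltNge le_weight.
Qed.

Lemma word_length1 : word_length 1%g = 0.
Proof.
apply/eqP; rewrite eq_le; apply/andP; split.
  by have := word_length_le [::]; rewrite /weight !big_nil.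
by apply: (@le_word_length (fun=> 0)) => // x y; rewrite addr0.
Qed.

Lemma word_lengthM x y : word_length (x * y)%g <= word_length x + word_length y.
Proof.
rewrite leNgt -ltrBrDl; apply/negP => /word_length_lt[t ty].
rewrite ltrBrDl -ltrBrDr => /word_length_lt[s sx]; rewrite ltrBrDr.
by apply/negP; rewrite -leNgt -sx -ty -big_cat /weight -big_cat; exact: word_length_le.
Qed.

Lemma word_lengthV : (forall x, w x^-1%g = w x) ->
  forall x, word_length x^-1%g = word_length x.
Proof.
move=> wV; have le x : word_length x^-1%g <= word_length x.
  rewrite leNgt; apply/negP => /word_length_lt[s <-]; apply/negP; rewrite -leNgt.
  have -> : ((\prod_(y <- s) y)^-1 = \prod_(y <- [seq y^-1 | y <- rev s]) y)%g.
    by rewrite big_map prodgV revK.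
  apply: le_trans (word_length_le _) _.
  rewrite /weight big_map (eq_bigr w) => [|y _]; last exact: wV.
  by rewrite (perm_big s)// perm_rev.
by move=> x; apply/eqP; rewrite eq_le le -{1}[x]invgK le.
Qed.

(** [y] is the letter at which the weight of the prefix first reaches [c]. *)
Lemma weight_split c s : 0 < c -> weight s < c \/
  exists p y q, [/\ s = p ++ y :: q, weight p < c & c <= weight p + w y].
Proof.
move=> c0; elim/last_ind: s => [|s z [sc|[p [y [q [-> pc cy]]]]]].
- by left; rewrite /weight big_nil.
- have [szc|csz] := ltP (weight (rcons s z)) c; [by left|right].
  exists s, z, [::]; split => //; first by rewrite cats1.
  by move: csz; rewrite /weight -cats1 big_cat/= big_seq1.
- by right; exists p, y, (rcons q z); split => //; rewrite rcons_cat rcons_cons.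
Qed.

End word_length.

(** * Exponential growth of the balls of the word length *)

Section growth.
Context {R : realType} {G : groupType}.
Variables (l : G -> R) (D : set G) (K : nat -> set G) (F : nat -> seq G).
Variable level : G -> nat.
Hypothesis l_ge0 : forall x, 0 <= l x.
Hypothesis l1 : l 1%g = 0.
Hypothesis lM : forall x y, l (x * y)%g <= l x + l y.
Hypothesis l_le1 : forall x, l x <= 1.

Let U : set G := [set x | l x < 1].

Hypothesis UUD : forall u v, U u -> U v -> D (u * v)%g.
Hypothesis UK : U `<=` K 0.
Hypothesis levelP : forall x, K (level x) x.
Hypothesis FP : forall m u v x, U u -> U v -> K m x ->
  exists2 a, a \in F m & U (a^-1 * (u * v * x))%g.

(** A cumulative sum, so that [cost m] is both larger than [size (F m) + m] and
    at least [cost 0]. *)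
Definition cost (m : nat) : nat := (\sum_(i < m.+1) (size (F i)).+1)%N.

Lemma cost_gt m : (size (F m) + m < cost m)%N.
Proof.
rewrite /cost big_ord_recr /= addnS ltnS addnC leq_add2r.
rewrite -[leqLHS]card_ord -sum1_card; exact: leq_sum.
Qed.


Definition letter_weight (x : G) : R :=
  if l x < 1 then (cost 0)%:R * l x else (cost (level x))%:R.

Lemma cost_gt0 m : (0 < cost m)%N.
Proof. exact: leq_trans (cost_gt m). Qed.

Lemma cost0_gt0 : 0 < (cost 0)%:R :> R.
Proof. by rewrite ltr0n cost_gt0. Qed.

Lemma cost0_le m : (cost 0 <= cost m)%N.
Proof. by rewrite /cost big_ord_recl big_ord0 addn0 big_ord_recl leq_addr. Qed.

Lemma scaled_le_letter_weight x : (cost 0)%:R * l x <= letter_weight x.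
Proof.
rewrite /letter_weight; case: ifP => // _.
by rewrite (le_trans (ler_piMr _ (l_le1 x)))// ler_nat cost0_le.
Qed.

Lemma letter_weight_ge0 x : 0 <= letter_weight x.
Proof.
by apply: le_trans (scaled_le_letter_weight x); rewrite mulr_ge0.
Qed.

(** The word is cut at the letter [y] where the accumulated weight reaches
    [cost 0]. The prefix is lighter than [cost 0], hence its product lies in
    [U]; the prefix together with [y] weighs at least [cost m], where [m = 0] is
    allowed when [y] is in [U] because [U] is contained in [K 0]. *)
Lemma first_jump n s : weight letter_weight s < n%:R ->
  U (\prod_(y <- s) y)%g \/
  exists m p y q, [/\ s = p ++ y :: q, U (\prod_(x <- p) x)%g, K m y,
    (cost m <= n)%N & weight letter_weight q < (n - cost m)%:R].
Proof.
have scaledU t : weight letter_weight t < (cost 0)%:R -> U (\prod_(y <- t) y)%g.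
  move=> tc; rewrite /U /= -(ltr_pM2l cost0_gt0) mulr1.
  apply: le_lt_trans tc; apply: (@le_weight _ _ _ (fun x => (cost 0)%:R * l x)).
  - by rewrite l1 mulr0.
  - by move=> x y; rewrite -mulrDr ler_pM2l// cost0_gt0.
  - exact: scaled_le_letter_weight.
move=> sn; have [/scaledU|] := weight_split letter_weight s cost0_gt0; first by left.
move=> [p [y [q [sE /scaledU Up cy]]]]; right.
have pqn : weight letter_weight p + letter_weight y + weight letter_weight q < n%:R.
  by move: sn; rewrite sE /weight big_cat big_cons/= addrA.
have p0 := weight_ge0 letter_weight_ge0 p.
have q0 := weight_ge0 letter_weight_ge0 q.
have [m [Ky my]] : exists m, K m y /\
    (cost m)%:R <= weight letter_weight p + letter_weight y.
  have [ly|ly] := ltP (l y) 1; first by exists 0%N; split => //; exact: UK.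
  exists (level y); split=> //.
  by rewrite /letter_weight ltNge ly /= lerDr.
have mn : (cost m <= n)%N by rewrite -(ler_nat R); lra.
by exists m, p, y, q; split => //; rewrite natrB//; lra.
Qed.

(** The sum of [size (F m) * 2 ^ (n - cost m)] is compared with the geometric
    series of the [2 ^ (n - m.+1)], since [size (F m) <= 2 ^ size (F m)] and
    [size (F m) + m < cost m]. The added term [2 ^ (n - j)] is the rest of that
    series; for [j = n] it leaves room for one more translate. *)
Lemma size_translates (t : nat -> seq G) n j :
  (forall k, (k < n)%N -> (size (t k) <= 2 ^ k)%N) -> (j <= n)%N ->
  (size (flatten [seq [seq (a * b)%g | a <- F m, b <- t (n - cost m)%N]
     | m <- iota 0 j & (cost m <= n)%N]) + 2 ^ (n - j) <= 2 ^ n)%N.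
Proof.
move=> tn; elim: j => [|j IHj] jn; first by rewrite subn0.
apply: leq_trans (IHj (ltnW jn)).
have halve : (2 ^ (n - j) = 2 ^ (n - j.+1) + 2 ^ (n - j.+1))%N.
  by rewrite addnn -mul2n -expnS subnSK.
rewrite -[in iota _ _]addn1 iotaD add0n filter_cat map_cat flatten_cat size_cat -addnA leq_add2l /=.
case: ifPn => [cn|_] /=; last by rewrite add0n halve leq_addl.
rewrite cats0 halve leq_add2r size_allpairs.
have cj := cost_gt j.
apply: leq_trans (_ : 2 ^ size (F j) * 2 ^ (n - cost j) <= _)%N.
  rewrite leq_mul ?(ltnW (ltn_expl _ _))// tn// ltn_subrL cost_gt0.
  exact: leq_trans jn.
by rewrite -expnD leq_exp2l//; lia.
Qed.

(** The extra factor [u] in [U] is what makes the induction work. The letter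
    produced by [first_jump] is covered together with everything on its left,
    and the error [a^-1 * (u * p * y)], again in [U], is passed on as the new
    left factor of the remainder. *)
Lemma weight_ball_cover n : exists2 s : seq G, (size s <= 2 ^ n)%N &
  forall u r, U u -> weight letter_weight r < n%:R ->
    exists2 a, a \in s & D (a^-1 * (u * \prod_(y <- r) y))%g.
Proof.
elim/ltn_ind: n => n IHn.
have [t tP] : {t : nat -> seq G & forall k, (k < n)%N ->
    (size (t k) <= 2 ^ k)%N /\ 
    forall u r, U u -> weight letter_weight r < k%:R ->
    exists2 a, a \in t k & D (a^-1 * (u * \prod_(y <- r) y))%g}.
  apply: (@choice _ _ (fun k tk => (k < n)%N ->
    (size tk <= 2 ^ k)%N /\ 
    forall u r, U u -> weight letter_weight r < k%:R ->
    exists2 a, a \in tk & D (a^-1 * (u * \prod_(y <- r) y))%g)) => k.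
  have [kn|nk] := ltnP k n; last by exists [::].
  by have [s ? ?] := IHn k kn; exists s.
pose s := flatten [seq [seq (a * b)%g | a <- F m, b <- t (n - cost m)%N]
     | m <- iota 0 n & (cost m <= n)%N].
exists (1%g :: s).
  have := @size_translates t n n (fun k kn => (tP k kn).1) (leqnn n).
  by rewrite subnn expn0 addn1.
move=> u r Uu /first_jump[Ur|[m [p [y [q [-> Up Ky mn qn]]]]]].
  (* A product in [U] is taken care of by the translate [1 * D]. *)
  by exists 1%g; rewrite ?mem_head// invg1 mul1g; exact: UUD.
have [a aF Ua] := FP Uu Up Ky.
have cm0 := cost_gt0 m.
have nm : (n - cost m < n)%N by rewrite ltn_subrL cm0 (leq_trans cm0).
have [b bt Db] := (tP _ nm).2 _ _ Ua qn.
exists (a * b)%g.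
  rewrite inE; apply/orP; right; apply/flattenP.
  exists [seq (a * b)%g | a <- F m, b <- t (n - cost m)%N].
    apply/mapP; exists m => //; rewrite mem_filter mn mem_iota /= add0n.
    by by rewrite (leq_trans _ mn)// (leq_trans _ (cost_gt m))// ltnS leq_addl.
  by apply/allpairsP; exists (a, b).
rewrite big_cat big_cons /= invgM.
by move: Db; rewrite !mulgA.
Qed.

End growth.

(** [c * l <= word_length w] everywhere, and [word_length w <= c * l] on the
    open unit ball of [l], so both lengths have the same small balls. *)
Lemma word_length_compatible (R : realType) (G : topologicalGroupType)
    (l w : G -> R) (c : R) : 0 < c -> compatible_length l ->
    (forall x, w x^-1%g = w x) -> (forall x, c * l x <= w x) ->
    (forall x, l x < 1 -> w x = c * l x) ->
  compatible_length (word_length w).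
Proof.
move=> c0 ll wV clw wcl.
have w0 x : 0 <= w x.
  by rewrite (le_trans _ (clw x))// mulr_ge0 ?(ltW c0)// length_ge0.
have cl_le x : c * l x <= word_length w x.
  apply: (@le_word_length _ _ _ (fun x => c * l x)) => [|{}x y|//].
    by rewrite (length1 ll) mulr0.
  by rewrite -mulrDr ler_pM2l//; apply: (lengthM ll).
split=> [|||V].
- exact: word_length1.
- exact: word_lengthV.
- exact: word_lengthM.
- rewrite (length_nbhs ll); split=> -[r r0 rV].
    exists (c * r); first exact: mulr_gt0.
    by move=> x /(le_lt_trans (cl_le x)); rewrite ltr_pM2l// => /rV.
  exists (Num.min 1 (r / c)); first by rewrite lt_min ltr01 divr_gt0.
  move=> x /=; rewrite lt_min => /andP[lx1 lxr]; apply: rV => /=.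
  by rewrite (le_lt_trans (word_length_le_letter w0 x))// wcl// mulrC -ltr_pdivlMr.
Qed.

(** * Measures of sets covered by translates *)

Section haar_covering.
Context {R : realType} {G : topologicalGroupType}.
Variable mu : {measure set (borelType G) -> \bar R}.

Lemma open_measurable_borel (A : set G) :
  open A -> measurable (A : set (borelType G)).
Proof. by move=> oA; apply: sub_sigma_algebra. Qed.

Lemma compact_measurable_borel (A : set G) : hausdorff_space G ->
  compact A -> measurable (A : set (borelType G)).
Proof.
move=> hG /(compact_closed hG)/closed_openC/open_measurable_borel/measurableC.
by rewrite setCK.
Qed.

Lemma haar_translates_le (A D : set G) (s : seq G) : hausdorff_space G ->
    is_left_haar mu -> measurable (A : set (borelType G)) -> compact D ->
    (forall x, A x -> exists2 a, a \in s & D (a^-1 * x)%g) ->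
  (mu A <= (size s)%:R%:E * mu D)%E.
Proof.
move=> hG haar mA cD AD.
pose aD k := [set (nth 1%g s k * x)%g | x in D].
have maD k : measurable (aD k : set (borelType G)).
  by apply: compact_measurable_borel => //; exact: compact_lmul.
have AaD : A `<=` \big[setU/set0]_(k < size s) aD k.
  move=> x /AD[a a_s Dx]; rewrite -bigcup_mkord.
  exists (index a s); first by rewrite /= index_mem.
  by exists (a^-1 * x)%g; rewrite ?nth_index ?mulVKg.
apply: le_trans (content_subadditive mu (fun k _ => maD k) mA AaD) _.
rewrite (eq_bigr (fun=> mu D)) => [|k _].
  by rewrite sumr_const card_ord mule_natl.
apply: haar_invariant => //; exact: compact_measurable_borel.
Qed.

End haar_covering.

Lemma dball_open (R : realType) (G : topologicalGroupType) (d : G -> G -> R) x r :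
  is_plig d -> open (dball d x r).
Proof.
move=> pd; apply/(plig_topology pd) => y xy; exists (r - d x y).
  by rewrite subr_gt0.
move=> z yz; rewrite /dball /= (le_lt_trans (is_metric_triangle (plig_metric pd) x y z))//.
by rewrite addrC -ltrBrDr.
Qed.

(** * The plig metric *)

Theorem theorem5p3 (R : realType) (G : topologicalGroupType)
    (hausdorffG : hausdorff_space G)
    (locally_compactG : locally_compact [set: G])
    (second_countableG : @second_countable G) :
  exists d : G -> G -> R, is_plig d /\
    forall mu : {measure set (borelType G) -> \bar R},
      is_left_haar mu -> exponentially_controlled_growth mu d.
Proof.
have [l [C [ll l_le1 cC lC]]] :=
  bounded_length_exists R hausdorffG locally_compactG second_countableG.
have [K0 [cK0 K0x]] := compact_exhaustion locally_compactG second_countableG.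
pose K m := (C `|` K0 m) `|` [set x^-1%g | x in C `|` K0 m].
have cK m : compact (K m).
  by apply: compactU; last apply: compact_inv; exact: compactU.
have KV m x : K m x^-1%g = K m x.
  rewrite propeqE; split=> -[Kx|[y Ky xy]].
  - by right; exists x^-1%g; rewrite ?invgK.
  - by left; rewrite -[x]invgK -xy invgK.
  - by right; exists x.
  - by left; rewrite -xy invgK.
(* [xget] depends on the set alone, so [level] inherits the symmetry of [K]. *)
pose level x := xget 0%N [set m | K m x].
have levelP x : K (level x) x.
  by have [m Kx] := K0x x; apply: (@xgetPex _ 0%N [set m | K m x]); exists m; left; right.
have levelV x : level x^-1%g = level x.
  by congr xget; apply/funext => m; exact: KV.
pose D := [set (x * y)%g | x in C & y in C].
have cD : compact D by exact: compact_mul.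
have UK : [set x | l x < 1] `<=` K 0%N by move=> x /lC Cx; left; left.
have UUD u v : l u < 1 -> l v < 1 -> D (u * v)%g.
  by move=> /lC Cu /lC Cv; exists u => //; exists v.
have [F FP] : {F : nat -> seq G & forall m u v x, l u < 1 -> l v < 1 -> K m x ->
    exists2 a, a \in F m & l (a^-1 * (u * v * x))%g < 1}.
  apply: (@choice _ _ (fun m (F : seq G) => forall u v x, l u < 1 -> l v < 1 ->
    K m x -> exists2 a, a \in F & l (a^-1 * (u * v * x))%g < 1)) => m.
  have U1 : nbhs (1%g : G) [set x | l x < 1] by apply/(length_nbhs ll); exists 1.
  have [F FP] := compact_translates (compact_mul cD (cK m)) U1.
  exists F => u v x lu lv Kx; apply: FP.
  by exists (u * v)%g; [exact: UUD|exists x].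
pose w := letter_weight l F level.
have l_ge0 x : 0 <= l x by exact: length_ge0.
have w_ge0 : forall x, 0 <= w x by exact: letter_weight_ge0.
have lw : compatible_length (word_length w).
  apply: (@word_length_compatible _ _ l _ (cost F 0)%:R) => //.
  - exact: cost0_gt0.
  - by move=> x; rewrite /w /letter_weight levelV (lengthV ll).
  - exact: scaled_le_letter_weight.
  - by move=> x lx; rewrite /w /letter_weight lx.
have cover n : exists2 s : seq G, (size s <= 2 ^ n)%N &
    forall x, word_length w x < n%:R -> exists2 a, a \in s & D (a^-1 * x)%g.
  have [s sn sD] := weight_ball_cover l_ge0 (length1 ll) (lengthM ll) l_le1
    UUD UK levelP FP n.
  exists s => // x /word_length_lt[r <- rn].
  have [|a a_s] := sD 1%g r _ rn; first by rewrite /= (length1 ll).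
  by rewrite mul1g; exists a.
have plig_d : is_plig (length_dist (word_length w)).
  apply: length_dist_plig => // n; have [s _ sD] := cover n.
  exists (\big[setU/set0]_(a <- s) [set (a * x)%g | x in D]).
    by apply: bigsetU_compact => a _; exact: compact_lmul.
  move=> x /sD[a a_s Dx]; rewrite -bigcup_seq; exists a => //.
  by exists (a^-1 * x)%g; rewrite ?mulVKg.
exists (length_dist (word_length w)); split => // mu haar.
have Dfin : mu D \is a fin_num.
  by rewrite ge0_fin_numE; [exact: haar_compact|exact: measure_ge0].
(* Adding [1] keeps the constant positive even if [D] has measure [0]. *)
exists (ln 2), (fine (mu D) + 1); split.
- by rewrite ln_gt0// ltr1n.
- by rewrite ltr_wpDl// fine_ge0// measure_ge0.
move=> n n0; have [s sn sD] := cover n.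
apply: le_trans (haar_translates_le (s := s) hausdorffG haar _ cD _) _.
- by apply: open_measurable_borel; exact: dball_open.
- by move=> x; rewrite /dball /length_dist /= invg1 mul1g; exact: sD.
rewrite -(fineK Dfin) -EFinM lee_fin mulrC.
rewrite expRM_natr lnK ?posrE// ler_pM ?fine_ge0 ?measure_ge0// ?lerDl//.
by rewrite -natrX ler_nat.
Qed.
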